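(* Let $G$ and $H$ be groups with finite inverse-closed generating sets $A$ and $B$, respectively. Let $\widetilde\gamma_G(z):=\widetilde\gamma(G,A)(z)=\sum_{i=0}^\infty r_iz^i$ and $\widetilde\gamma_H(z):=\widetilde\gamma(H,B)(z)=\sum_{i=0}^\infty s_iz^i$ be the geodesic conjugacy growth series, and let $\gamma_G:=\gamma(G,A)$ and $\gamma_H:=\gamma(H,B)$ be the geodesic growth series for these pairs. (i) The geodesic conjugacy growth series $\widetilde\gamma_\times$ of the direct product $G\times H=\langle G,H\mid [G,H]\rangle$ with respect to the generating set $A\cup B$ is given by $\widetilde\gamma_\times=\sum_{i=0}^\infty\delta_iz^i$, where $\delta_i:=\sum_{j=0}^i\binom{i}{j}r_js_{i-j}$. (ii) The geodesic conjugacy growth series $\widetilde\gamma_*$ of the free product $G*H$ with respect to the generating set $A\cup B$ is given by $$\widetilde\gamma_*-1=(\widetilde\gamma_G-1)+(\widetilde\gamma_H-1)-z\frac{d}{dz}\ln\left[1-(\gamma_G-1)(\gamma_H-1)\right].$$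
   Context: For a group $G$ with finite inverse-closed generating set $X$, let $\pi:X^*\to G$ be the natural projection and $l(w)$ the length of a word $w\in X^*$. For $g\in G$, $|g|$ is the length of a shortest word over $X$ representing $g$, and $|g|_c:=\min\{|h| : h\text{ conjugate to }g\text{ in }G\}$. The geodesic language is $\Gamma(G,X):=\{w\in X^*: l(w)=|\pi(w)|\}$ and the geodesic conjugacy language is $\widetilde\Gamma(G,X):=\{w\in X^*: l(w)=|\pi(w)|_c\}$. The strict growth series of a language $L\subseteq X^*$ is $f_L(z)=\sum_{i\ge0}|\{w\in L: l(w)=i\}|\,z^i$. The geodesic growth series is $\gamma(G,X):=f_{\Gamma(G,X)}$ and the geodesic conjugacy growth series is $\widetilde\gamma(G,X):=f_{\widetilde\Gamma(G,X)}$. All identities are between (formal) power series in $z$; $\ln[1-u(z)]$ for a power series $u$ with zero constant term means $-\sum_{n\ge1}u(z)^n/n$. *)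

(* Defs.v *)
From HB Require Import structures.
From mathcomp Require Import all_boot all_order all_algebra.
From mathcomp Require Import finmap boolp.

Set Implicit Arguments.
Unset Strict Implicit.
Unset Printing Implicit Defensive.

Import GRing.Theory.

Section Fps.
Variable R : comNzRingType.
Local Open Scope ring_scope.

Record fps := Fps { fps_coef :> nat -> R }.

Lemma fpsP (f g : fps) : f =1 g -> f = g.
Proof. by case: f g => f [g] /= fg; congr Fps; apply: funext. Qed.

HB.instance Definition _ := gen_eqMixin fps.
HB.instance Definition _ := gen_choiceMixin fps.

Definition fps_add (f g : fps) := Fps (fun n => f n + g n).
Definition fps_opp (f : fps) := Fps (fun n => - f n).
Definition fps_mul (f g : fps) :=
  Fps (fun n => \sum_(i < n.+1) f i * g (n - i)%N).
Definition fps_zero := Fps (fun=> 0).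
Definition fps_one := Fps (fun n => (n == 0)%:R).

Fact fps_addA : associative fps_add.
Proof. by move=> f g h; apply: fpsP => n /=; rewrite addrA. Qed.
Fact fps_addC : commutative fps_add.
Proof. by move=> f g; apply: fpsP => n /=; rewrite addrC. Qed.
Fact fps_add0 : left_id fps_zero fps_add.
Proof. by move=> f; apply: fpsP => n /=; rewrite add0r. Qed.
Fact fps_addN : left_inverse fps_zero fps_opp fps_add.
Proof. by move=> f; apply: fpsP => n /=; rewrite addNr. Qed.

HB.instance Definition _ :=
  GRing.isZmodule.Build fps fps_addA fps_addC fps_add0 fps_addN.

Let trunc n (f : fps) : {poly R} := \poly_(i < n.+1) f i.

Let truncE n f i : (i <= n)%N -> (trunc n f)`_i = f i.
Proof. by move=> le_in; rewrite coef_poly ltnS le_in. Qed.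

Let trunc_mul n f g i : (i <= n)%N ->
  (trunc n f * trunc n g)`_i = fps_mul f g i.
Proof.
move=> le_in; rewrite coefM; apply: eq_bigr => j _.
have le_ji : (j <= i)%N := leq_ord j.
by rewrite !truncE ?(leq_trans le_ji) ?(leq_trans (leq_subr _ _)).
Qed.

Fact fps_mulC : commutative fps_mul.
Proof. by move=> f g; apply: fpsP => n; rewrite -!(@trunc_mul n)// mulrC. Qed.

Fact fps_mulA : associative fps_mul.
Proof.
have mulA f g h n :
    fps_mul (fps_mul f g) h n = (trunc n f * trunc n g * trunc n h)`_n.
  rewrite coefM; apply: eq_bigr => j _; have le_jn : (j <= n)%N := leq_ord j.
  by rewrite trunc_mul // truncE // leq_subr.
move=> f g h; apply: fpsP => n.
by rewrite fps_mulC !mulA mulrC mulrA.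
Qed.

Fact fps_mul1 : left_id fps_one fps_mul.
Proof.
move=> f; apply: fpsP => n /=.
rewrite big_ord_recl /= mul1r subn0 big1 ?addr0 // => i _.
by rewrite mul0r.
Qed.

Fact fps_mulDl : left_distributive fps_mul fps_add.
Proof.
move=> f g h; apply: fpsP => n /=.
by rewrite -big_split; apply: eq_bigr => i _; rewrite mulrDl.
Qed.

Fact fps_one_neq0 : fps_one != fps_zero.
Proof.
by apply/eqP => /(congr1 (fun f : fps => f 0%N)) /eqP; rewrite /= oner_eq0.
Qed.

HB.instance Definition _ := GRing.Zmodule_isComNzRing.Build fps
  fps_mulA fps_mulC fps_mul1 fps_mulDl fps_one_neq0.

Definition fpsX : fps := Fps (fun n => (n == 1)%:R).

Definition fps_deriv (f : fps) : fps := Fps (fun n => f n.+1 *+ n.+1).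

End Fps.

(** [fps_ln1B u] is ln[1 - u] = - \sum_(k >= 1) u ^+ k / k, meaningful only
    when u 0 = 0: then u ^+ k has no term of degree < k, so that only the k <= n
    contribute to the coefficient of degree n. *)
Definition fps_ln1B (F : fieldType) (u : fps F) : fps F :=
  Fps (fun n => - \sum_(1 <= k < n.+1) (u ^+ k)%R n / k%:R)%R.

(** The minimum of a set of natural numbers, 0 if the set is empty. *)
Definition min_nat (P : nat -> Prop) : nat :=
  if pselect (exists n, `[< P n >]) is left exP then ex_minn exP else 0.

Section Words.
Variables (G : groupType) (X : {fset G}).
Local Open Scope group_scope.

Definition inverse_closed := forall x, x \in X -> x^-1 \in X.

Definition generates := forall g : G, exists s : seq G,
  (forall x, x \in s -> x \in X \/ x^-1 \in X) /\ \prod_(x <- s) x = g.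

Definition wordval (w : seq X) : G := \prod_(x <- w) val x.

Definition wlen (g : G) : nat :=
  min_nat (fun n => exists w : seq X, wordval w = g /\ size w = n).

Definition conj_wlen (g : G) : nat :=
  min_nat (fun n => exists x : G, wlen (g ^ x) = n).

Definition geodesic_lang : pred (seq X) :=
  [pred w | size w == wlen (wordval w)].

Definition conj_geodesic_lang : pred (seq X) :=
  [pred w | size w == conj_wlen (wordval w)].

End Words.

Definition growth_series (T : finType) (L : pred (seq T)) : fps rat :=
  Fps (fun n => #|[set w : n.-tuple T | L w]|%:R%R).

Definition geodesic_growth (G : groupType) (X : {fset G}) : fps rat :=
  growth_series (@geodesic_lang G X).

Definition conj_geodesic_growth (G : groupType) (X : {fset G}) : fps rat :=
  growth_series (@conj_geodesic_lang G X).

(** The free product G * H in normal form: its elements are the sequences of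
    nontrivial elements of G and H, taken alternately from G and from H. *)
Section FreeProduct.
Variables G H : groupType.
Local Open Scope group_scope.

Let letter := (G + H)%type.

Definition fp_nontrivial (x : letter) : bool :=
  match x with inl g => g != 1 | inr h => h != 1 end.

Definition fp_alternate (x y : letter) : bool :=
  match x, y with inl _, inr _ | inr _, inl _ => true | _, _ => false end.

Definition fp_reduced (w : seq letter) : bool :=
  all fp_nontrivial w && sorted fp_alternate w.

Record freeprod := FreeProd { fpval :> seq letter; _ : fp_reduced fpval }.

HB.instance Definition _ := [isSub for fpval].
HB.instance Definition _ := [Choice of freeprod by <:].

(** Left multiplication of a reduced sequence by one (maybe trivial) letter. *)
Definition fp_push (x : letter) (w : seq letter) : seq letter :=
  match x, w with
  | inl g, inl g' :: w' => if g * g' == 1 then w' else inl (g * g') :: w'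
  | inr h, inr h' :: w' => if h * h' == 1 then w' else inr (h * h') :: w'
  | _, _ => if fp_nontrivial x then x :: w else w
  end.

Definition fp_letter_inv (x : letter) : letter :=
  match x with inl g => inl g^-1 | inr h => inr h^-1 end.

Let mulw (u v : seq letter) := foldr fp_push v u.
Let invw (u : seq letter) := rev (map fp_letter_inv u).

Lemma fp_reduced_cons x w : fp_reduced (x :: w) =
  [&& fp_nontrivial x, fp_reduced w
    & if w is y :: _ then fp_alternate x y else true].
Proof.
rewrite /fp_reduced /=; case: w => [|y w] /=; first by rewrite !andbT.
by rewrite -!andbA; do !bool_congr; rewrite andbC -!andbA.
Qed.

Lemma fp_push_reduced x w : fp_reduced w -> fp_reduced (fp_push x w).
Proof.
have red_if y v : fp_reduced v ->
    (if v is z :: _ then fp_alternate y z else true) ->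
    fp_reduced (if fp_nontrivial y then y :: v else v).
  by move=> rv yv; case: ifP => // ny; rewrite fp_reduced_cons ny rv.
case: w => [|y w] rw; first by case: x => x; apply: red_if.
case: x y rw => [g|h] [g'|h'] rw; do ?[exact: red_if].
all: move: rw; rewrite fp_reduced_cons /= => /and3P[_ rw aw].
all: by case: eqP => // /eqP ng; rewrite fp_reduced_cons /= ng rw; case: w aw {rw}.
Qed.

Lemma fp_push1 w : fp_reduced w ->
  fp_push (inl 1) w = w /\ fp_push (inr 1) w = w.
Proof.
case: w => [|[g|h] w]; rewrite ?fp_reduced_cons /= ?eqxx //= => /andP[n1 _];
  by rewrite mul1g (negPf n1).
Qed.

Lemma fp_push_inl g g' w : fp_reduced w ->
  fp_push (inl (g * g')) w = fp_push (inl g) (fp_push (inl g') w).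
Proof.
case: w => [|[k|k] w] rw /=.
- by case: (altP (g' =P 1)) => [->|_] /=; rewrite ?mulg1 //; case: eqP.
- rewrite -mulgA; case: (altP (g' * k =P 1)) => [->|//].
  move: rw; rewrite fp_reduced_cons mulg1 => /and3P[_ rw aw].
  by case: w rw aw => [|[a|b] w] //= _ _; case: eqP.
- by case: (altP (g' =P 1)) => [->|_] /=; rewrite ?mulg1 //; case: eqP.
Qed.

Lemma fp_push_inr h h' w : fp_reduced w ->
  fp_push (inr (h * h')) w = fp_push (inr h) (fp_push (inr h') w).
Proof.
case: w => [|[k|k] w] rw /=.
- by case: (altP (h' =P 1)) => [->|_] /=; rewrite ?mulg1 //; case: eqP.
- by case: (altP (h' =P 1)) => [->|_] /=; rewrite ?mulg1 //; case: eqP.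
- rewrite -mulgA; case: (altP (h' * k =P 1)) => [->|//].
  move: rw; rewrite fp_reduced_cons mulg1 => /and3P[_ rw aw].
  by case: w rw aw => [|[a|b] w] //= _ _; case: eqP.
Qed.

Let mulw_reduced u v : fp_reduced v -> fp_reduced (mulw u v).
Proof. by move=> rv; elim: u => //= x u IHu; apply: fp_push_reduced. Qed.

Let mulw_push x u v : fp_reduced v ->
  mulw (fp_push x u) v = fp_push x (mulw u v).
Proof.
move=> rv.
have nt y u' : mulw (if fp_nontrivial y then y :: u' else u') v =
               fp_push y (mulw u' v).
  case: ifPn => // y1; have [p1 p2] := fp_push1 (mulw_reduced u' rv).
  by case: y y1 => y /negPn /eqP ->.
case: u => [|y u]; first by rewrite -nt; case: x.
have [p1 p2] := fp_push1 (mulw_reduced u rv).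
case: x y => [g|h] [g'|h'].
- change (mulw (if g * g' == 1 then u else inl (g * g') :: u) v =
          fp_push (inl g) (fp_push (inl g') (mulw u v))).
  by rewrite -fp_push_inl ?mulw_reduced //; case: eqP => // ->.
- exact: (nt (inl g) (inr h' :: u)).
- exact: (nt (inr h) (inl g' :: u)).
- change (mulw (if h * h' == 1 then u else inr (h * h') :: u) v =
          fp_push (inr h) (fp_push (inr h') (mulw u v))).
  by rewrite -fp_push_inr ?mulw_reduced //; case: eqP => // ->.
Qed.

Let mulwA u v w : fp_reduced w -> mulw u (mulw v w) = mulw (mulw u v) w.
Proof. by move=> rw; elim: u => //= x u ->; rewrite mulw_push. Qed.

Let mulw1 u : fp_reduced u -> mulw u [::] = u.
Proof.
elim: u => //= x u IHu; rewrite fp_reduced_cons => /and3P[n1 ru au].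
rewrite IHu //; case: x n1 au => x /= n1; case: u {IHu ru} => [|[] y u] //=;
  by rewrite n1.
Qed.

Let fp_letter_invK : involutive fp_letter_inv.
Proof. by case=> x /=; rewrite invgK. Qed.

Let invwK : involutive invw.
Proof. by move=> u; rewrite /invw map_rev revK mapK. Qed.

Let invw_reduced u : fp_reduced u -> fp_reduced (invw u).
Proof.
have altC x y : fp_alternate y x = fp_alternate x y by case: x y => ? [].
rewrite /fp_reduced /invw all_rev rev_sorted => /andP[nt au].
apply/andP; split.
  by rewrite all_map; apply: sub_all nt => -[] x /=; rewrite invg_eq1.
rewrite sorted_map; apply: sub_sorted au => x y /=.
by case: x y => ? [].
Qed.

Let mulVw u : fp_reduced u -> mulw (invw u) u = [::].
Proof.
elim: u => //= x u IHu; rewrite fp_reduced_cons => /and3P[n1 ru au].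
rewrite /invw /= rev_cons /mulw foldr_rcons.
suff -> : fp_push (fp_letter_inv x) (x :: u) = u by exact: IHu.
by case: x n1 au => x /= _ _; rewrite mulVg eqxx.
Qed.

Definition fp_one : freeprod := @FreeProd [::] isT.
Definition fp_mul (u v : freeprod) : freeprod :=
  FreeProd (mulw_reduced u (valP v)).
Definition fp_inv (u : freeprod) : freeprod :=
  FreeProd (invw_reduced (valP u)).

Fact fp_mulA : associative fp_mul.
Proof. by move=> u v w; apply/val_inj/mulwA/valP. Qed.
Fact fp_mul1g : left_id fp_one fp_mul.
Proof. by move=> u; apply/val_inj. Qed.
Fact fp_mulg1 : right_id fp_one fp_mul.
Proof. by move=> u; apply/val_inj/mulw1/valP. Qed.
Fact fp_mulVg : left_inverse fp_one fp_inv fp_mul.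
Proof. by move=> u; apply/val_inj/mulVw/valP. Qed.
Fact fp_mulgV : right_inverse fp_one fp_inv fp_mul.
Proof.
move=> u; rewrite -{1}(_ : fp_inv (fp_inv u) = u) ?fp_mulVg //.
exact/val_inj/invwK.
Qed.

HB.instance Definition _ :=
  isGroup.Build freeprod fp_mulA fp_mul1g fp_mulg1 fp_mulVg fp_mulgV.

Definition fp_inl (g : G) : freeprod :=
  FreeProd (@fp_push_reduced (inl g) [::] isT).
Definition fp_inr (h : H) : freeprod :=
  FreeProd (@fp_push_reduced (inr h) [::] isT).

Lemma fp_inlM : {morph fp_inl : x y / x * y}.
Proof.
move=> x y; apply/val_inj => /=.
rewrite -[LHS]/(fp_push (inl (x * y)) [::]) fp_push_inl //.
exact/esym/(@mulw_push (inl x) [::] (fp_push (inl y) [::]))/fp_push_reduced.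
Qed.

Lemma fp_inrM : {morph fp_inr : x y / x * y}.
Proof.
move=> x y; apply/val_inj => /=.
rewrite -[LHS]/(fp_push (inr (x * y)) [::]) fp_push_inr //.
exact/esym/(@mulw_push (inr x) [::] (fp_push (inr y) [::]))/fp_push_reduced.
Qed.

Lemma freeprod_universal (K : groupType) (f : G -> K) (g : H -> K) :
    {morph f : x y / x * y} -> {morph g : x y / x * y} ->
  exists! k : freeprod -> K,
    [/\ {morph k : x y / x * y}, k \o fp_inl =1 f & k \o fp_inr =1 g].
Proof.
move=> fM gM.
have f1 : f 1 = 1 by apply: (@mulgI _ (f 1)); rewrite -fM !mulg1.
have g1 : g 1 = 1 by apply: (@mulgI _ (g 1)); rewrite -gM !mulg1.
pose c (x : letter) := match x with inl a => f a | inr b => g b end.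
pose k (w : seq letter) := \prod_(x <- w) c x.
have kpush x w : k (fp_push x w) = c x * k w.
  have nt y v : k (if fp_nontrivial y then y :: v else v) = c y * k v.
    case: ifPn => [_|]; first by rewrite /k big_cons.
    by case: y => y /negPn /eqP -> /=; rewrite ?f1 ?g1 mul1g.
  case: w => [|y w]; first by rewrite -nt; case: x.
  case: x y => [a|b] [a'|b'].
  - rewrite /k big_cons /= mulgA -fM.
    by case: eqP => [->|_]; rewrite ?f1 ?mul1g // big_cons.
  - exact: (nt (inl a) (inr b' :: w)).
  - exact: (nt (inr b) (inl a' :: w)).
  - rewrite /k big_cons /= mulgA -gM.
    by case: eqP => [->|_]; rewrite ?g1 ?mul1g // big_cons.
have k0 : k [::] = 1 by rewrite /k big_nil.
have kcons x w : k (x :: w) = c x * k w by rewrite /k big_cons.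
have kM u v : k (mulw u v) = k u * k v.
  by elim: u => [|x u IHu]; rewrite ?k0 ?mul1g // kpush IHu kcons mulgA.
exists (fun u : freeprod => k u); split.
  split=> [u v|a|b]; first exact: kM.
    exact: etrans (kpush (inl a) [::]) (etrans (congr1 _ k0) (mulg1 _)).
  exact: etrans (kpush (inr b) [::]) (etrans (congr1 _ k0) (mulg1 _)).
move=> k' [k'M k'l k'r]; apply: funext => -[w rw].
elim: w rw => [|x w IHw] rw.
  rewrite k0; apply/esym/(@mulgI _ (k' (FreeProd rw))).
  by rewrite -k'M mulg1; congr k'; apply/val_inj.
have [nx rw' _] := and3P (etrans (esym (fp_reduced_cons x w)) rw).
pose y := match x with inl a => fp_inl a | inr b => fp_inr b end.
have eq_y : FreeProd rw = y * FreeProd rw'.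
  apply/val_inj; rewrite /= -/(mulw _ _).
  have -> : fpval y = [:: x] by rewrite /y; case: (x) nx => ? /= ->.
  rewrite -[RHS]/(fp_push x w) -[in RHS](mulw1 rw').
  by rewrite -[RHS]/(mulw (x :: w) [::]) mulw1.
rewrite -[LHS]/(k (x :: w)) kcons eq_y k'M -IHw; congr (_ * _).
by rewrite /y; case: (x) => a; [apply/esym/k'l | apply/esym/k'r].
Qed.

End FreeProduct.

Definition dprod_gens (G H : groupType) (A : {fset G}) (B : {fset H}) :
    {fset (G * H)%type} :=
  ([fset (a, 1%g) | a in A] `|` [fset (1%g, b) | b in B])%fset.

Definition fprod_gens (G H : groupType) (A : {fset G}) (B : {fset H}) :
    {fset (freeprod G H)} :=
  ([fset fp_inl H a | a in A] `|` [fset fp_inr G b | b in B])%fset.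

(* Main.v *)
Require Import Defs.
From mathcomp Require Import all_boot all_order all_algebra.
From mathcomp Require Import finmap boolp.
From mathcomp Require Import zify ring.
Import GRing.Theory.

(** In a direct product, lengths and conjugacy lengths add, so a conjugacy
    geodesic word is a shuffle of two such words, one in each factor.

    In a free product, word length is the sum of the lengths of the syllables of
    the normal form. If the first and the last syllable of g lie in different
    factors then |g^n| = n |g|, and this forces |g|_c = |g|, since |x^-1 g^n x|
    differs from |g^n| by at most a constant. Hence the conjugacy geodesic words
    that use letters of both factors are the rotations of the concatenations of
    k >= 1 blocks (nonempty geodesic over A)(nonempty geodesic over B). Such a
    word w has exactly k rotations of this form; weighting each of them by 1/k
    counts w once. Summing over the n rotations gives, in degree n, the
    coefficient of n * sum_k ((gamma_G - 1)(gamma_H - 1))^k / k, which is that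
    of - z d/dz ln[1 - (gamma_G - 1)(gamma_H - 1)]. *)

Set Implicit Arguments.
Unset Strict Implicit.
Unset Printing Implicit Defensive.

Local Open Scope ring_scope.

(** * Weighted counts of words *)

Section WeightedSeries.
Variable T : finType.
Implicit Types (phi psi : seq T -> rat) (L : pred (seq T)).

(** Weights are rational because a cyclic word will be shared among its rotations with fractional
    weights. *)
Definition wseries phi : fps rat := Fps (fun n => \sum_(w : n.-tuple T) phi w).

Lemma growth_seriesE L : growth_series L = wseries (fun w => (L w)%:R).
Proof.
apply: fpsP => n /=; rewrite -sum1_card natr_sum big_mkcond /=.
by apply: eq_bigr => w _; rewrite inE; case: (L w).
Qed.

Lemma eq_wseries phi psi : phi =1 psi -> wseries phi = wseries psi.
Proof. by move=> E; apply: fpsP => n /=; apply: eq_bigr => w _. Qed.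

Lemma wseries0 phi : wseries phi 0 = phi [::].
Proof.
rewrite /= (big_pred1 [tuple]) // => w; exact/esym/eqP/tuple0.
Qed.

Lemma wseriesS phi n :
  wseries phi n.+1 = \sum_x wseries (fun w => phi (x :: w)) n.
Proof.
rewrite /= (pair_big xpredT xpredT (fun x (w : n.-tuple T) => phi (x :: w))) /=.
rewrite (reindex (fun p : T * n.-tuple T => cons_tuple p.1 p.2)) //=.
exists (fun w : n.+1.-tuple T => (thead w, behead_tuple w)) => [[x w] _|w _] /=.
  by rewrite theadE; congr pair; apply: val_inj.
by rewrite [RHS]tuple_eta; apply: val_inj.
Qed.

Definition conv phi psi : seq T -> rat :=
  fun w => \sum_(i < (size w).+1) phi (take i w) * psi (drop i w).

(** The Cauchy product enumerates words with a marked cut. The induction removes the first letter: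
    the cut at 0 is split off, and every other cut is a cut of the tail, for the weight shifted by
    that letter. *)
Lemma wseries_conv phi psi : wseries (conv phi psi) = wseries phi * wseries psi.
Proof.
apply: fpsP => n; elim: n phi => [|n IHn] phi.
  rewrite wseries0 /conv /= !big_ord_recl !big_ord0 !addr0.
  by rewrite -[LHS]/(phi [::] * psi [::]) -!wseries0.
rewrite wseriesS.
have convE x w : conv phi psi (x :: w) =
    phi [::] * psi (x :: w) + conv (fun w => phi (x :: w)) psi w.
  by rewrite /conv big_ord_recl.
rewrite (eq_bigr (fun x => phi [::] * wseries (fun w => psi (x :: w)) n +
   (wseries (fun w => phi (x :: w)) * wseries psi) n)); last first.
  move=> x _; rewrite -IHn /= mulr_sumr -big_split.
  by apply: eq_bigr => w _; rewrite convE.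
rewrite big_split -mulr_sumr -wseriesS /=.
rewrite [RHS]big_ord_recl subn0; congr (_ + _); first by rewrite -wseries0.
rewrite exchange_big; apply: eq_bigr => i _ /=.
by rewrite -mulr_suml subSS -(wseriesS phi i).
Qed.

Lemma wseries_rot phi r n :
  wseries (fun w => phi (rot r w)) n = wseries phi n.
Proof.
rewrite /= [RHS](reindex_inj (h := fun w : n.-tuple T => rot_tuple r w)) //=.
by move=> v w /(congr1 val) /= /rot_inj E; apply: val_inj.
Qed.

End WeightedSeries.

(** Injectivity is asked only on letters of words of [L]: letters of the two factors can coincide at
    the identity, which geodesic words avoid. *)
Lemma growth_series_map (S T : finType) (f : S -> T) (L : pred (seq T)) :
    (forall w, L w -> {subset w <= codom f}) ->
    (forall s, L (map f s) -> {in s, forall x y, f x = f y -> x = y}) ->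
  growth_series L = growth_series [pred s | L (map f s)].
Proof.
move=> Lf f_inj; apply: fpsP => n /=; congr (_%:R).
rewrite -(@card_in_imset _ _ (map_tuple f)) => [|s t].
  apply/eq_card => w; rewrite inE.
  apply/idP/imsetP => [Lw|[s]]; last by rewrite inE => Ls ->.
  have [s fs] : exists s, map f s = w :> seq T.
    elim: (w : seq T) (Lf _ Lw) => [|x v IHv] vf; first by exists [::].
    have /codomP[y ->] : x \in codom f by rewrite vf ?mem_head.
    by have [z zv|s <-] := IHv; [rewrite vf // inE zv orbT | exists (y :: s)].
  have sn : size s == n by rewrite -(size_map f) fs size_tuple.
  by exists (Tuple sn); rewrite ?inE /= ?fs //; apply: val_inj.
rewrite !inE => /f_inj s_inj _ /(congr1 val) /= E; apply: val_inj => /=.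
elim: (val s) (val t) s_inj E => [|x u IHu] [|y v] //= s_inj [fxy E].
congr cons; first exact: s_inj (mem_head x u) _ fxy.
by apply: IHu E => z zu; apply: s_inj; rewrite inE zu orbT.
Qed.

(** * Shuffles of words over two alphabets *)

Section Shuffle.
Variables A B : finType.
Implicit Types (w : seq (A + B)) (P : pred (seq A)) (Q : pred (seq B)).

Definition lefts w : seq A :=
  pmap (fun x => if x is inl a then Some a else None) w.
Definition rights w : seq B :=
  pmap (fun x => if x is inr b then Some b else None) w.

Lemma size_lefts_rights w : size w = (size (lefts w) + size (rights w))%N.
Proof. by elim: w => [|[a|b] w IHw] //=; rewrite IHw ?addnS. Qed.

Lemma wseries_sum (phi : seq (A + B) -> rat) n :
  wseries phi n.+1 = \sum_a wseries (fun w => phi (inl a :: w)) n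
                     + \sum_b wseries (fun w => phi (inr b :: w)) n.
Proof. by rewrite wseriesS big_sumType. Qed.

(** A word over [A + B] amounts to its two projections together with the positions of its left
    letters, whence the binomial coefficient. Splitting on the first letter turns this into Pascal's
    rule. *)
Lemma wseries_shuffle (phi : seq A -> rat) (psi : seq B -> rat) n :
  wseries (fun w => phi (lefts w) * psi (rights w)) n =
  \sum_(j < n.+1) 'C(n, j)%:R * wseries phi j * wseries psi (n - j)%N.
Proof.
elim: n phi psi => [|n IHn] phi psi.
  by rewrite big_ord1 bin0 mul1r !wseries0.
rewrite wseries_sum big_ord_recl bin0 mul1r subn0.
under eq_bigr do rewrite (IHn (fun u => phi (_ :: u))).
under [X in _ + X = _]eq_bigr do rewrite (IHn _ (fun u => psi (_ :: u))).
rewrite exchange_big [X in _ + X = _]exchange_big /=.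
have -> : \sum_(j < n.+1) \sum_a 'C(n, j)%:R *
     wseries (fun u => phi (a :: u)) j * wseries psi (n - j)%N
   = \sum_(j < n.+1) 'C(n, j)%:R * wseries phi j.+1 * wseries psi (n - j)%N.
  apply: eq_bigr => j _.
  by rewrite wseriesS -mulr_suml -mulr_sumr.
have -> : \sum_(j < n.+1) \sum_b 'C(n, j)%:R *
     wseries phi j * wseries (fun u => psi (b :: u)) (n - j)%N
   = \sum_(j < n.+1) 'C(n, j)%:R * wseries phi j * wseries psi (n.+1 - j)%N.
  apply: eq_bigr => j _.
  by rewrite -mulr_sumr subSn ?leq_ord // wseriesS.
rewrite [X in _ + X]big_ord_recl bin0 mul1r subn0 addrCA; congr (_ + _).
(* The shifted second sum gains the index [j = n], where ['C(n, n.+1)] is 0, so that both ranges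
   agree. *)
transitivity (\sum_(j < n.+1)
    'C(n, j)%:R * wseries phi j.+1 * wseries psi (n - j)%N
  + \sum_(j < n.+1) 'C(n, j.+1)%:R * wseries phi j.+1 * wseries psi (n - j)%N).
  congr (_ + _); rewrite [RHS]big_ord_recr /= bin_small // !mul0r addr0.
  by apply: eq_bigr => j _; rewrite subSS.
rewrite -big_split; apply: eq_bigr => j _ /=.
by rewrite binS natrD subSS -!mulrDl addrC.
Qed.

End Shuffle.

(** * Cyclic words in two colours *)

(** [b] is the colour just before [s], which lets counts over consecutive pieces add up. *)
Fixpoint ascents (b : bool) (s : seq bool) : nat :=
  if s is c :: s' then ((~~ b && c) + ascents c s')%N else 0%N.

Definition cyclic_ascents (s : seq bool) := ascents (last false s) s.

(** A circular word cut open at an ascent; the defaults exclude the empty word. *)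
Definition up_down (s : seq bool) := head false s && ~~ last true s.

Lemma ascents_cat b s t :
  ascents b (s ++ t) = (ascents b s + ascents (last b s) t)%N.
Proof. by elim: s b => [|c s IHs] b //=; rewrite IHs addnA. Qed.

Lemma ascents_nseq b c n : b || ~~ c -> ascents b (nseq n c) = 0%N.
Proof.
elim: n b => //= n IHn b bc.
by rewrite IHn ?orbN // addn0 -[_ && _]negbK negb_and negbK bc. Qed.

Lemma last_nseq (b : bool) n : last b (nseq n b) = b.
Proof. by elim: n. Qed.

Lemma leq_ascents b s : (ascents b s <= size s)%N.
Proof. by elim: s b => //= c s IHs b; rewrite -add1n leq_add ?leq_b1. Qed.

Lemma cyclic_ascents_rot r s : cyclic_ascents (rot r s) = cyclic_ascents s.
Proof.
rewrite -{2}(cat_take_drop r s) /rot.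
case: (take r s) (drop r s) => [|a u] [|b v]; rewrite ?cats0 //.
by rewrite /cyclic_ascents !ascents_cat !last_cat addnC.
Qed.

(** The circle has an ascent at position [r] exactly when the rotation by [r] starts with [true] and
    ends with [false]. *)
Lemma cyclic_ascents_sum s :
  cyclic_ascents s = (\sum_(r < size s) up_down (rot r s))%N.
Proof.
have ascE b t : ascents b t =
    (\sum_(r < size t) (~~ last b (take r t) && nth false t r))%N.
  elim: t b => [|c t IHt] b /=; first by rewrite big_ord0.
  by rewrite big_ord_recl IHt.
rewrite /cyclic_ascents ascE; apply: eq_bigr => r _; congr nat_of_bool.
have Ed := drop_nth false (ltn_ord r).
have -> : last false s = last (nth false s r) (drop r.+1 s).
  by rewrite -{1}(cat_take_drop r s) last_cat Ed.
by rewrite /up_down /rot Ed /= last_cat andbC.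
Qed.

Lemma up_down_cyclic_ascents s :
  up_down s -> cyclic_ascents s = ascents false s.
Proof. by rewrite /cyclic_ascents; case: s => //= a s /andP[_ /= /negPf->]. Qed.

(** Without ascents, a sequence ending in [true] is constantly [true], and one entered from [false]
    never reaches [true]. *)
Lemma cyclic_ascents_gt0 s : has id s -> has negb s -> (0 < cyclic_ascents s)%N.
Proof.
have all_last b t : ascents b t = 0%N -> last b t -> b && all id t.
  elim: t b => [|c t IHt] b /=; first by rewrite andbT.
  move=> /eqP; rewrite addn_eq0 => /andP[bc /eqP at0] /(IHt _ at0)/andP[ct ->].
  by move: bc; rewrite ct; case: b.
have all_first t : ascents false t = 0%N -> ~~ has id t.
  by elim: t => //= -[] t IHt //= /IHt.
rewrite lt0n /cyclic_ascents => s1 s0; apply/eqP => a0.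
case E: (last false s) a0 => a0; last by have := all_first _ a0; rewrite s1.
have /(all_last _ _ a0)/allP s_all : last true s.
  by move: E; clear; case: s => //= c t ->.
by have /hasP[x /s_all /= ->] := s0.
Qed.

(** * Cyclic geodesic words that use both colours *)

Section ColouredWords.
Variables (T : finType) (col : T -> bool) (geod C : pred (seq T)).
Hypothesis geod0 : geod [::].
Hypothesis geod_cat : forall x u y v, col (last x u) != col y ->
  geod ((x :: u) ++ y :: v) = geod (x :: u) && geod (y :: v).
Hypothesis C_rot : forall r w, C (rot r w) = C w.
Hypothesis C_geod : forall x w,
  col x -> ~~ col (last x w) -> C (x :: w) = geod (x :: w).

Definition syllable b : pred (seq T) :=
  [pred w | [&& w != [::], all (fun x => col x == b) w & geod w]].

Definition syllable_series b := growth_series (syllable b).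

(* The linear representatives, cut before an ascent, of the cyclic geodesic
   words that have 2k syllables. *)
Definition cyclic_geodesic (k : nat) : pred (seq T) :=
  [pred w | [&& (w == [::]) || up_down (map col w),
                geod w & ascents false (map col w) == k]].

Definition break (b : bool) w := find (fun x => col x != b) w.

Definition starts (b : bool) (w : seq T) :=
  if w is x :: _ then col x == b else true.

(* A factorization whose first factor is b-coloured and whose second factor does
   not start with b can only cut at the end of the leading b-coloured block. *)
Lemma conv_break b (P : pred (seq T)) (phi : seq T -> rat) w :
    (forall v, P v -> all (fun x => col x == b) v) ->
    (forall v, ~~ starts (~~ b) v -> phi v = 0) ->
  conv (fun v => (P v)%:R) phi w =
    (P (take (break b w) w))%:R * phi (drop (break b w) w).
Proof.
move=> Pb phi_b; rewrite /conv.
have lt_bw : (break b w < (size w).+1)%N by rewrite ltnS find_size.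
rewrite (bigD1 (Ordinal lt_bw)) //= big1 ?addr0 // => i ne_i.
have {ne_i}: (i : nat) != break b w by [].
case: ltngtP => // [lt_i | gt_i] _.
  rewrite [phi _]phi_b ?mulr0 //.
  have lt_iw : (i < size w)%N by apply: leq_trans lt_i _; rewrite -ltnS.
  case E: (drop i w) => [|x v].
    by move: (size_drop i w); rewrite E /=; lia.
  have := before_find x lt_i.
  rewrite -[nth x w i]/(head x (nth x w i :: drop i.+1 w)).
  by rewrite -drop_nth // E /=; case: (col x) (b) => [] [].
case Pi: (P _); last by rewrite mul0r.
have lt_w : (break b w < size w)%N by apply: leq_trans gt_i _; rewrite -ltnS.
have x0 : T by case: (w) lt_w => // x.
have := lt_w; rewrite -has_find => /(nth_find x0) /negP[].
have /allP := Pb _ Pi; apply.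
by rewrite -(nth_take _ gt_i) mem_nth // size_takel // -ltnS.
Qed.

Lemma break_cat b p w : all (fun x => col x == b) p -> starts (~~ b) w ->
  break b (p ++ w) = size p.
Proof.
move=> pb wb; rewrite /break find_cat ifN -?all_predC; last first.
  by apply: sub_all pb => x /= /eqP ->; rewrite eqxx.
case: w wb => [|x w] /=; rewrite ?addn0 // => /eqP ->.
by case: b {pb}; rewrite addn0.
Qed.

Lemma map_col b p : all (fun x => col x == b) p -> map col p = nseq (size p) b.
Proof.
by move=> pb; rewrite -(size_map col); apply/all_pred1P; rewrite all_map.
Qed.

(** [geod_cat] splits the word at its colour changes, and [p] contributes exactly one ascent, since
    the count resumes from the [false] ending [q]. If [p] or [q] is empty, both sides are false: the
    word is empty, starts with [false], or ends with [true]. *)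
Lemma cyclic_geodesicS k p q w :
    all (fun x => col x == true) p -> all (fun x => col x == false) q ->
    starts true w -> (q = [::] -> w = [::]) ->
  cyclic_geodesic k.+1 (p ++ q ++ w) =
    [&& syllable true p, syllable false q & cyclic_geodesic k w].
Proof.
move=> p1 q0 w1 qw; have [/= mp mq] := (map_col p1, map_col q0).
case: p => [|x p] in p1 mp *.
  case: q => [|y q] /= in q0 mq qw *.
    by rewrite qw // /cyclic_geodesic /= andbF.
  by rewrite /cyclic_geodesic /= /up_down /=; case: (col y) q0.
case: q => [|y q] in q0 mq qw *.
  rewrite qw // /cyclic_geodesic /= /up_down /=.
  by case: mp => -> mp; rewrite cats0 mp last_nseq andbF.
have ne_xy : col (last x p) != col y.
  case/andP: q0 => /eqP -> _.
  by have /allP/(_ (last x p))/(_ (mem_last _ _))/eqP -> := p1.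
have geodE : geod (x :: p ++ y :: q ++ w) =
    [&& geod (x :: p), geod (y :: q) & geod w].
  rewrite -[LHS]/(geod ((x :: p) ++ y :: (q ++ w))) geod_cat //; congr (_ && _).
  case: w w1 {qw} => [|z w] /= z1; first by rewrite cats0 geod0 andbT.
  rewrite -cat_cons geod_cat // (eqP z1).
  by have /allP/(_ (last y q))/(_ (mem_last _ _))/eqP -> := q0.
rewrite /cyclic_geodesic /syllable /up_down /= geodE !map_cat.
have p1' : all (fun x => col x == true) p by case/andP: p1.
have q0' : all (fun x => col x == false) q by case/andP: q0.
case: mp mq => cx mp [cy mq]; rewrite /= !map_cat p1' q0' cx cy mp mq.
rewrite last_cat ascents_cat /= last_cat ascents_cat !last_nseq.
rewrite !ascents_nseq //=.
rewrite !add0n add1n eqSS -!andbA.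
case: w w1 {geodE qw} => [|z w] /= z1; first by rewrite geod0.
rewrite (eqP z1) /=; case: (~~ _) => /=; rewrite ?andbF //.
Qed.

(** Both blocks are taken maximal. What follows [p] is then empty or starts with [false], which
    gives the last clause. *)
Lemma break_decomposition w : exists p q v,
  [/\ w = p ++ q ++ v, all (fun x => col x == true) p,
      all (fun x => col x == false) q, starts true v & (q = [::] -> v = [::])].
Proof.
have brk b v : all (fun x => col x == b) (take (break b v) v)
               /\ starts (~~ b) (drop (break b v) v).
  elim: v => //= x v [IHb IHv]; rewrite /break /=; case: eqP => [e|/eqP nb] /=.
    by rewrite e eqxx.
  by split=> //; move: nb; clear; case: (col x) b => [] [].
have [[p1 w1] [q0 v1]] := (brk true w, brk false (drop (break true w) w)).
exists (take (break true w) w).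
exists (take (break false (drop (break true w) w)) (drop (break true w) w)).
exists (drop (break false (drop (break true w) w)) (drop (break true w) w)).
split; rewrite ?cat_take_drop //.
case: (drop (break true w) w) w1 => // x v /eqP x0.
by rewrite /break /= x0.
Qed.

(** Factorization into syllables is unique: each convolution has a single possibly nonzero term by
    [conv_break], as the remainder after a syllable must be empty or start with the other colour. *)
Lemma cyclic_geodesicS_conv k w : (cyclic_geodesic k.+1 w)%:R =
  conv (fun p => (syllable true p)%:R)
    (conv (fun q => (syllable false q)%:R)
          (fun v => (cyclic_geodesic k v)%:R)) w.
Proof.
have syl b v : syllable b v -> all (fun x => col x == b) v by case/and3P.
have cycE v : conv (fun q => (syllable false q)%:R)
                (fun v => (cyclic_geodesic k v)%:R) v =
              (syllable false (take (break false v) v))%:R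
              * (cyclic_geodesic k (drop (break false v) v))%:R.
  apply: conv_break => [u|u]; first exact: syl.
  case: u => //= x u; rewrite /cyclic_geodesic /= /up_down /=.
  by case: (col x).
rewrite (conv_break (b := true)); last 2 first.
- exact: syl.
- case=> //= x u nx; by rewrite cycE /break /= nx mul0r.
have [p [q [v [-> p1 q0 v1 qv]]]] := break_decomposition w.
rewrite cyclic_geodesicS // cycE break_cat //; last first.
  by case: q q0 qv => [|y q] //= => [_ -> //|/andP[]].
rewrite take_size_cat // drop_size_cat // break_cat //.
by rewrite take_size_cat // drop_size_cat // -!natrM !mulnb andbA.
Qed.

Lemma cyclic_geodesic_series k :
  growth_series (cyclic_geodesic k) =
  (syllable_series true * syllable_series false) ^+ k.
Proof.
elim: k => [|k IHk]; last first.
  rewrite exprS -IHk /syllable_series !growth_seriesE -mulrA -!wseries_conv.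
  exact/eq_wseries/cyclic_geodesicS_conv.
(* For [k = 0] only the empty word counts: a nonempty representative starts with [true], already an
   ascent from [false]. *)
apply: fpsP => -[|n]; rewrite growth_seriesE.
  by rewrite wseries0 /cyclic_geodesic /= geod0.
rewrite /= big1 // => -[[|x w] //= _] _.
rewrite /cyclic_geodesic /= /up_down /=.
by case: (col x); rewrite ?andbF.
Qed.

Definition mixed w := has col w && has (predC col) w.

Lemma mixed_cyclic_series n :
  growth_series [pred w | C w && mixed w] n =
  n%:R * \sum_(1 <= k < n.+1)
    ((syllable_series true * syllable_series false) ^+ k) n / k%:R.
Proof.
pose asc w := cyclic_ascents (map col w).
pose linear w := up_down (map col w).
have asc_gt0 w : mixed w -> (0 < asc w)%N.
  by case/andP=> w1 w0; apply: cyclic_ascents_gt0; rewrite has_map.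
have mixed_linear w : linear w -> mixed w.
  rewrite /linear /mixed; case: w => //= x w /andP[/= cx cl]; rewrite cx /=.
  apply/hasP; exists (last x w) => /=.
    have := mem_last x w; rewrite inE => /orP[/eqP e|//].
    by move: cl; rewrite last_map e cx.
  by rewrite -last_map.
have mixed_rot r w : mixed (rot r w) = mixed w by rewrite /mixed !has_rot.
rewrite growth_seriesE.
(* By rotation invariance of [C] and [asc], the sum over all rotations of a word can be replaced by
   [n] copies of one sum over linear words. *)
transitivity (\sum_(r < n)
    wseries (fun w => (C w && linear w)%:R / (asc w)%:R : rat) n).
  transitivity (\sum_(r < n)
      wseries (fun w => (C w && linear (rot r w))%:R / (asc w)%:R : rat) n);
    last first.
    apply: eq_bigr => r _; rewrite -[RHS](wseries_rot _ r).
    apply: eq_bigr => w _.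
    by rewrite C_rot /asc map_rot cyclic_ascents_rot.
  rewrite /= exchange_big; apply: eq_bigr => w _ /=.
  rewrite -mulr_suml; case Cw: (C w); last by rewrite big1 ?mul0r.
  rewrite -natr_sum /=.
  have ascE : (\sum_(r < n) linear (rot r w))%N = asc w.
    rewrite /asc cyclic_ascents_sum size_map size_tuple.
    by apply: eq_bigr => r _; rewrite /linear map_rot.
  (* A mixed word has [asc w] linear rotations of weight [1 / asc w] each; any other word has
     none. *)
  case mw: (mixed w).
    by rewrite ascE divff // Num.Theory.pnatr_eq0 -lt0n asc_gt0.
  rewrite big1 ?mul0r // => r _; case lin: (linear _) => //.
  by rewrite -(mixed_rot r) mixed_linear in mw.
rewrite sumr_const card_ord -[LHS]mulr_natl; congr (_ * _).
(* Linear words are sorted by their number [k] of ascents, which lies between 1 and [n]. *)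
transitivity (\sum_(1 <= k < n.+1) \sum_(w : n.-tuple T)
    (cyclic_geodesic k w)%:R / k%:R : rat); last first.
  apply: eq_bigr => k _.
  by rewrite -cyclic_geodesic_series growth_seriesE /= mulr_suml.
rewrite exchange_big; apply: eq_bigr => w _ /=; rewrite /cyclic_geodesic /=.
(* A word that is not linear can only enter [cyclic_geodesic] by being empty, which forces [k = 0],
   outside the range. *)
case lin: (linear w); last first.
  rewrite andbF mul0r big_seq big1 // => k.
  rewrite mem_index_iota => /andP[k0 _].
  rewrite -/(linear w) lin orbF; case: eqP => [->|_]; rewrite ?mul0r //=.
  by rewrite ltn_eqF // andbF mul0r.
rewrite andbT -/(linear w) lin orbT /=.
have -> : C w = geod w.
  move: (lin); rewrite /linear /up_down.
  case: (tval w) => //= x u /andP[cx cl]; apply: C_geod => //.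
  by rewrite -last_map.
rewrite -up_down_cyclic_ascents // (bigD1_seq (asc w)) ?iota_uniq //=;
  last first.
  rewrite mem_index_iota asc_gt0 ?mixed_linear //= ltnS.
  by rewrite -[n in (_ <= n)%N](size_tuple w) -(size_map col) leq_ascents.
rewrite eqxx andbT big1 ?addr0 // => k /negPf k_asc.
by rewrite eq_sym k_asc andbF mul0r.
Qed.

End ColouredWords.

(** * Word length and conjugacy length *)

Section WordLength.
Local Open Scope group_scope.
Variables (G : groupType) (X : {fset G}).
Implicit Types (g h : G) (u v w : seq X).

Lemma min_natP (P : nat -> Prop) n : P n -> P (min_nat P) /\ (min_nat P <= n)%N.
Proof.
move=> Pn; rewrite /min_nat; case: pselect => [exP|[]]; last first.
  by exists n; apply/asboolP.
case: ex_minnP => m /asboolP Pm le_m; split=> //.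
by apply: le_m; apply/asboolP.
Qed.

Lemma wordval_cat u v : wordval (u ++ v) = wordval u * wordval v.
Proof. by rewrite /wordval big_cat. Qed.

Lemma wlen_wordval w : (wlen X (wordval w) <= size w)%N.
Proof.
by have [] := @min_natP (fun n => exists v, wordval v = wordval w /\ size v = n)
  (size w) (ex_intro _ w (conj erefl erefl)).
Qed.

Lemma wlen1 : wlen X 1 = 0%N.
Proof.
apply/eqP; rewrite -leqn0; have := wlen_wordval [::].
by rewrite /wordval big_nil.
Qed.

Lemma conj_wlen_leJ g x : (conj_wlen X g <= wlen X (g ^ x))%N.
Proof.
by have [] := @min_natP (fun n => exists y : G, wlen X (g ^ y) = n) _
  (ex_intro _ x erefl).
Qed.

Lemma conj_wlen_le g : (conj_wlen X g <= wlen X g)%N.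
Proof. by rewrite -{2}[g]conjg1 conj_wlen_leJ. Qed.

Lemma conj_wlenP g : exists x, wlen X (g ^ x) = conj_wlen X g.
Proof.
by have [] := @min_natP (fun n => exists y : G, wlen X (g ^ y) = n) _
  (ex_intro _ 1 erefl).
Qed.

Lemma conj_wlenJ g x : conj_wlen X (g ^ x) = conj_wlen X g.
Proof.
apply/eqP; rewrite eqn_leq; apply/andP; split.
  have [y <-] := conj_wlenP g.
  by rewrite -[y](mulVKg x) conjgM conj_wlen_leJ.
have [y <-] := conj_wlenP (g ^ x).
by rewrite -conjgM conj_wlen_leJ.
Qed.

Lemma conj_geodesic_nil : conj_geodesic_lang ([::] : seq X).
Proof.
rewrite /conj_geodesic_lang /= eq_sym -leqn0 /wordval big_nil.
by apply: leq_trans (conj_wlen_le _) _; rewrite wlen1.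
Qed.

(** Generation as a monoid, the form in which an inverse-closed generating set is used. *)
Definition spanning := forall g, exists w : seq X, wordval w = g.

Hypothesis X_span : spanning.

Lemma wlenP g : exists2 w : seq X, wordval w = g & size w = wlen X g.
Proof.
have [w wg] : exists w : seq X, wordval w = g := X_span g.
have [[v [vg vn]] _] := @min_natP
  (fun n => exists v : seq X, wordval v = g /\ size v = n)
  (size w) (ex_intro _ w (conj wg erefl)).
by exists v.
Qed.

Lemma wlenM g h : (wlen X (g * h) <= wlen X g + wlen X h)%N.
Proof.
have [[u <- <-] [v <- <-]] := (wlenP g, wlenP h).
by rewrite -wordval_cat -size_cat wlen_wordval.
Qed.

Lemma wlenX g n : (wlen X (g ^+ n) <= n * wlen X g)%N.
Proof.
elim: n => [|n IHn]; first by rewrite expg0 wlen1.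
by rewrite expgS mulSn (leq_trans (wlenM _ _)) // leq_add2l.
Qed.

Lemma geodesic_cat u v :
  geodesic_lang (u ++ v) -> geodesic_lang u && geodesic_lang v.
Proof.
rewrite /geodesic_lang /= wordval_cat size_cat => /eqP uv.
have := wlenM (wordval u) (wordval v).
have := wlen_wordval u; have := wlen_wordval v.
by rewrite -uv !eqn_leq; lia.
Qed.

Lemma conj_geodesicW w : conj_geodesic_lang w -> geodesic_lang w.
Proof.
rewrite /conj_geodesic_lang /= => /eqP w_min.
rewrite /geodesic_lang /= eqn_leq wlen_wordval andbT w_min.
exact: conj_wlen_le.
Qed.

(** The one-letter factor [[:: x]] is itself geodesic, whereas the identity has length 0. *)
Lemma geodesic_neq1 w x : geodesic_lang w -> x \in w -> val x != 1.
Proof.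
move=> wG /path.splitPr xw; case: xw wG => u v /geodesic_cat/andP[_].
rewrite -cat1s => /geodesic_cat/andP[+ _]; apply: contraTneq => x1.
by rewrite /geodesic_lang /= /wordval big_seq1 x1 wlen1.
Qed.

(** Rotation conjugates the value of the word by the value of the prefix that is moved. *)
Lemma conj_geodesic_rot r w :
  conj_geodesic_lang (rot r w) = conj_geodesic_lang w.
Proof.
rewrite /conj_geodesic_lang /= size_rot.
have -> : wordval w = wordval (take r w) * wordval (drop r w).
  by rewrite -wordval_cat cat_take_drop.
rewrite wordval_cat -(conj_wlenJ (_ * wordval (drop r w)) (wordval (take r w))).
by rewrite conjgE -mulgA mulKg.
Qed.

(* Conjugate elements have conjugate powers, whose lengths differ by a constant
   independent of the exponent. *)
Lemma conj_wlen_stable g :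
  (forall n, wlen X (g ^+ n) = n * wlen X g)%N -> conj_wlen X g = wlen X g.
Proof.
move=> gX; apply/eqP; rewrite eqn_leq conj_wlen_le /=.
have [x <-] := conj_wlenP g; set h := g ^ x.
(* [c] bounds the cost of conjugating back. If [h] were shorter than [g], the lengths would differ
   by at least [n] at the power [n], so [n = c + 1] suffices. *)
pose c := (wlen X x + wlen X x^-1)%N; pose n := c.+1.
have : (wlen X (g ^+ n) <= c + n * wlen X h)%N.
  rewrite -[g ^+ n](conjgK x) conjXg -/h conjgE invgK.
  apply: leq_trans (wlenM _ _) _; rewrite /c -addnA leq_add2l.
  by apply: leq_trans (wlenM _ _) _; rewrite addnC leq_add2l wlenX.
rewrite gX => le_n; rewrite leqNgt; apply/negP => lt_h.
have : (n * (wlen X h).+1 <= n * wlen X g)%N by rewrite leq_mul2l lt_h orbT.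
by rewrite mulnS /n; lia.
Qed.

End WordLength.

Lemma morph_mul1 (G K : groupType) (f : G -> K) :
  {morph f : x y / (x * y)%g} -> f 1%g = 1%g.
Proof. by move=> fM; apply: (@mulgI _ (f 1%g)); rewrite -fM !mulg1. Qed.

Lemma morph_conjg (G K : groupType) (f : G -> K) :
  {morph f : x y / (x * y)%g} -> {morph f : x y / (x ^ y)%g}.
Proof. by move=> fM x y; apply: (@mulgI _ (f y)); rewrite -fM -!conjgC fM. Qed.

(** * Two factors embedded in a group that retracts onto each of them *)

Section TwoFactors.
Local Open Scope group_scope.
Variables (G H K : groupType) (A : {fset G}) (B : {fset H}).
Variables (f : G -> K) (g : H -> K) (f' : K -> G) (g' : K -> H).
Hypotheses (fM : {morph f : x y / x * y}) (gM : {morph g : x y / x * y}).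
Hypotheses (f'M : {morph f' : x y / x * y}) (g'M : {morph g' : x y / x * y}).
Hypotheses (fK : cancel f f') (gK : cancel g g').
Hypotheses (f'g : forall b, f' (g b) = 1) (g'f : forall a, g' (f a) = 1).

Definition factor_gens := ([fset f a | a in A] `|` [fset g b | b in B])%fset.

Hypotheses (A_span : spanning A) (B_span : spanning B).
Hypothesis X_span : spanning factor_gens.
Implicit Types (c : A + B) (w : seq (A + B)).

Lemma letter_subproof c :
  (if c is inl a then f (val a) else if c is inr b then g (val b) else 1)
    \in factor_gens.
Proof.
by case: c => [a|b]; rewrite inE; apply/orP; [left|right]; apply: in_imfset;
  apply: valP.
Qed.

(** Words are handled over the disjoint sum [A + B], although the images of [A] and [B] may share
    the identity. *)
Definition letter c : factor_gens := [` letter_subproof c]%fset.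

Lemma letter_surj x : exists c, letter c = x.
Proof.
case: x => x Xx; have := Xx; rewrite inE => /orP[] /imfsetP[/= y Fy xy].
  by exists (inl [` Fy]%fset); apply: val_inj.
by exists (inr [` Fy]%fset); apply: val_inj.
Qed.

(** The factors meet trivially: applying [f'] to [f a = g b] gives [a = 1]. *)
Lemma letter_inj c c' : val (letter c) != 1 -> letter c = letter c' -> c = c'.
Proof.
move=> + /(congr1 val) /=.
have gf a b : f a = g b -> f a = 1.
  by move=> fg; rewrite -[a]fK fg f'g (morph_mul1 fM).
case: c c' => [a|b] [a'|b'] /= n1.
- by move/(can_inj fK)/val_inj->.
- by move/gf => f1; rewrite f1 eqxx in n1.
- by move=> e; rewrite e (gf _ _ (esym e)) eqxx in n1.
- by move/(can_inj gK)/val_inj->.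
Qed.

Lemma word_letters (v : seq factor_gens) : exists w, map letter w = v.
Proof.
elim: v => [|x v [w <-]]; first by exists [::].
by have [c <-] := letter_surj x; exists (c :: w).
Qed.

Lemma conj_geodesic_growth_letters : conj_geodesic_growth factor_gens =
  growth_series [pred w | conj_geodesic_lang (map letter w)].
Proof.
apply: growth_series_map =>
  [v _ x _|w /conj_geodesicW/(geodesic_neq1 X_span) w1].
  by have [c <-] := letter_surj x; apply: codom_f.
by move=> c cw c'; apply: letter_inj; apply/w1/map_f.
Qed.

Lemma wordval_inl u : wordval (map letter (map inl u)) = f (wordval u).
Proof.
elim: u => [|a u IHu]; first by rewrite /wordval !big_nil (morph_mul1 fM).
by rewrite /wordval !big_cons in IHu *; rewrite fM IHu.
Qed.

Lemma wordval_inr u : wordval (map letter (map inr u)) = g (wordval u).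
Proof.
elim: u => [|a u IHu]; first by rewrite /wordval !big_nil (morph_mul1 gM).
by rewrite /wordval !big_cons in IHu *; rewrite gM IHu.
Qed.

Lemma retract_wordval w : f' (wordval (map letter w)) = wordval (lefts w)
  /\ g' (wordval (map letter w)) = wordval (rights w).
Proof.
rewrite /wordval; elim: w => [|c w [IHf IHg]].
  by rewrite !big_nil (morph_mul1 f'M) (morph_mul1 g'M).
rewrite !big_cons f'M g'M IHf IHg.
case: c => [a|b] /=; first by rewrite fK g'f mul1g big_cons.
by rewrite gK f'g mul1g big_cons.
Qed.

(** Each retraction erases the letters of the other factor, so a shortest word for [x] splits into
    words for its two images. *)
Lemma wlen_retract x :
  (wlen A (f' x) + wlen B (g' x) <= wlen factor_gens x)%N.
Proof.
have [v <- <-] := wlenP X_span x; have [w <-] := word_letters v.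
have [-> ->] := retract_wordval w.
by rewrite size_map size_lefts_rights leq_add ?wlen_wordval.
Qed.

Lemma wlen_factor a b :
  (wlen factor_gens (f a * g b) <= wlen A a + wlen B b)%N.
Proof.
have [[u <- <-] [v <- <-]] := (wlenP A_span a, wlenP B_span b).
rewrite -wordval_inl -wordval_inr -wordval_cat.
by apply: leq_trans (wlen_wordval _) _; rewrite size_cat !size_map.
Qed.

Lemma wlen_inl a : wlen factor_gens (f a) = wlen A a.
Proof.
apply/eqP; rewrite eqn_leq; have := wlen_retract (f a); have := wlen_factor a 1.
by rewrite fK g'f (morph_mul1 gM) mulg1 wlen1 addn0 => -> ->.
Qed.

Lemma wlen_inr b : wlen factor_gens (g b) = wlen B b.
Proof.
apply/eqP; rewrite eqn_leq; have := wlen_retract (g b); have := wlen_factor 1 b.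
by rewrite gK f'g (morph_mul1 fM) mul1g wlen1 add0n => -> ->.
Qed.

(** The retractions send a shortest conjugate of [x] to conjugates of [f' x] and [g' x]. *)
Lemma conj_wlen_retract x :
  (conj_wlen A (f' x) + conj_wlen B (g' x) <= conj_wlen factor_gens x)%N.
Proof.
have [y <-] := conj_wlenP factor_gens x; apply: leq_trans (wlen_retract _).
by rewrite (morph_conjg f'M) (morph_conjg g'M) leq_add ?conj_wlen_leJ.
Qed.

Lemma conj_wlen_inl a : conj_wlen factor_gens (f a) = conj_wlen A a.
Proof.
apply/eqP; rewrite eqn_leq; apply/andP; split.
  have [x <-] := conj_wlenP A a.
  by rewrite -wlen_inl (morph_conjg fM) conj_wlen_leJ.
by apply: leq_trans (conj_wlen_retract _); rewrite fK leq_addr.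
Qed.

Lemma conj_wlen_inr b : conj_wlen factor_gens (g b) = conj_wlen B b.
Proof.
apply/eqP; rewrite eqn_leq; apply/andP; split.
  have [x <-] := conj_wlenP B b.
  by rewrite -wlen_inr (morph_conjg gM) conj_wlen_leJ.
by apply: leq_trans (conj_wlen_retract _); rewrite gK leq_addl.
Qed.

Lemma geodesic_inl u : geodesic_lang (map letter (map inl u)) = geodesic_lang u.
Proof. by rewrite /geodesic_lang /= wordval_inl wlen_inl !size_map. Qed.

Lemma geodesic_inr u : geodesic_lang (map letter (map inr u)) = geodesic_lang u.
Proof. by rewrite /geodesic_lang /= wordval_inr wlen_inr !size_map. Qed.

Lemma conj_geodesic_inl u :
  conj_geodesic_lang (map letter (map inl u)) = conj_geodesic_lang u.
Proof.
by rewrite /conj_geodesic_lang /= wordval_inl conj_wlen_inl !size_map.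
Qed.

Lemma conj_geodesic_inr u :
  conj_geodesic_lang (map letter (map inr u)) = conj_geodesic_lang u.
Proof.
by rewrite /conj_geodesic_lang /= wordval_inr conj_wlen_inr !size_map.
Qed.

End TwoFactors.

(** * Direct products *)

Lemma generates_spanning (G : groupType) (X : {fset G}) :
  inverse_closed X -> generates X -> spanning X.
Proof.
move=> X_inv X_gen x; have [s [sX <-]] := X_gen x.
elim: s sX => [|y s IHs] sX; first by exists [::]; rewrite /wordval !big_nil.
have [|w wE] := IHs; first by move=> z zs; apply: sX; rewrite inE zs orbT.
have Xy : y \in X.
  by have [//|/X_inv] := sX y (mem_head _ _); rewrite invgK.
by exists ([` Xy]%fset :: w); rewrite /wordval !big_cons -wE.
Qed.

Section DirectProduct.
Local Open Scope group_scope.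
Variables (G H : groupType) (A : {fset G}) (B : {fset H}).
Hypotheses (A_span : spanning A) (B_span : spanning B).

Let f (a : G) : G * H := (a, 1).
Let g (b : H) : G * H := (1, b).
Let fM : {morph f : x y / x * y}.
Proof. by move=> x y; congr pair; rewrite mulg1. Qed.
Let gM : {morph g : x y / x * y}.
Proof. by move=> x y; congr pair; rewrite mulg1. Qed.
Let fstM : {morph @fst G H : x y / x * y}. Proof. by []. Qed.
Let sndM : {morph @snd G H : x y / x * y}. Proof. by []. Qed.
Let fK : cancel f fst. Proof. by []. Qed.
Let gK : cancel g snd. Proof. by []. Qed.
Let fst_g b : (g b).1 = 1. Proof. by []. Qed.
Let snd_f a : (f a).2 = 1. Proof. by []. Qed.

Let dprodE (x : G * H) : x = f x.1 * g x.2.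
Proof. by case: x => a b; congr pair; rewrite ?mulg1 ?mul1g. Qed.

Lemma dprod_spanning : spanning (dprod_gens A B).
Proof.
move=> x; have [[u uE] [v vE]] := (A_span x.1, B_span x.2).
exists (map (@letter _ _ _ A B f g) (map inl u ++ map inr v)).
by rewrite map_cat wordval_cat wordval_inl // wordval_inr // uE vE -dprodE.
Qed.

(** The two coordinates can be conjugated independently, so a single pair minimizes both lengths. *)
Lemma conj_wlen_dprod (x : G * H) :
  conj_wlen (dprod_gens A B) x = (conj_wlen A x.1 + conj_wlen B x.2)%N.
Proof.
apply/eqP; rewrite eqn_leq; apply/andP; split; last first.
  exact: (conj_wlen_retract fstM sndM fK gK fst_g snd_f dprod_spanning).
have [[y <-] [z <-]] := (conj_wlenP A x.1, conj_wlenP B x.2).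
apply: leq_trans (conj_wlen_leJ _ x (y, z)) _.
by rewrite [x ^ _]dprodE; apply: wlen_factor.
Qed.

Lemma conj_geodesic_growth_dprod :
  conj_geodesic_growth (dprod_gens A B) =
  Fps (fun i => \sum_(j < i.+1) 'C(i, j)%:R * conj_geodesic_growth A j
                 * conj_geodesic_growth B (i - j)%N)%R.
Proof.
apply: fpsP => n.
rewrite [LHS](congr1 (fun F : fps rat => F n)
  (conj_geodesic_growth_letters fM fK gK fst_g dprod_spanning)).
rewrite growth_seriesE -[RHS]/(\sum_(j < n.+1) 'C(n, j)%:R
  * conj_geodesic_growth A j * conj_geodesic_growth B (n - j)%N)%R.
rewrite /conj_geodesic_growth !growth_seriesE -wseries_shuffle.
apply: eq_bigr => w _; rewrite -natrM mulnb; congr (_%:R)%R; congr nat_of_bool.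
rewrite /conj_geodesic_lang /= conj_wlen_dprod.
have [-> ->] := retract_wordval fstM sndM fK gK fst_g snd_f (tval w).
rewrite size_map size_lefts_rights.
(* Each projection is at least as long as the conjugacy length of its value, so equality of the sums
   forces equality in both factors. *)
have := leq_trans (conj_wlen_le A _) (wlen_wordval (lefts (tval w))).
have := leq_trans (conj_wlen_le B _) (wlen_wordval (rights (tval w))).
move: (size (lefts _)) (size (rights _)) (conj_wlen _ _) (conj_wlen _ _).
by move=> a b c d; lia.
Qed.

End DirectProduct.

(** * Free products *)

Lemma freeprod_retraction (G H K : groupType) (f : G -> K) (g : H -> K) :
    {morph f : x y / (x * y)%g} -> {morph g : x y / (x * y)%g} ->
  exists k : freeprod G H -> K, [/\ {morph k : x y / (x * y)%g},
    forall a, k (fp_inl H a) = f a & forall b, k (fp_inr G b) = g b].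
Proof.
move=> fM gM; have [k [[kM kf kg] _]] := freeprod_universal fM gM.
by exists k.
Qed.

(** * Syllable lengths, geodesics and conjugacy geodesics in a free product *)

Section FreeProductWords.
Local Open Scope group_scope.
Variables (G H : groupType) (A : {fset G}) (B : {fset H}).
Hypotheses (A_span : spanning A) (B_span : spanning B).

Local Notation f := (@fp_inl G H).
Local Notation g := (@fp_inr G H).
Local Notation X := (fprod_gens A B).
Local Notation "'ltr'" := (@letter G H (freeprod G H) A B f g).
Implicit Types (c d : A + B) (w : seq (A + B)) (x : G + H) (s : seq (G + H)).

Lemma fpval_mul_inl a (u : freeprod G H) : fpval (f a * u) = fp_push (inl a) u.
Proof.
rewrite -[LHS]/(foldr (@fp_push G H) u (fpval (f a))).
have [u1 u2] := fp_push1 (valP u).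
case: (eqVneq a 1) => [->|n1]; first by rewrite ?u1 ?u2 /= eqxx.
by rewrite -[fpval (f a)]/(if a != 1 then [:: inl a] else [::]) n1.
Qed.

Lemma fpval_mul_inr b (u : freeprod G H) : fpval (g b * u) = fp_push (inr b) u.
Proof.
rewrite -[LHS]/(foldr (@fp_push G H) u (fpval (g b))).
have [u1 u2] := fp_push1 (valP u).
case: (eqVneq b 1) => [->|n1]; first by rewrite ?u1 ?u2 /= eqxx.
by rewrite -[fpval (g b)]/(if b != 1 then [:: inr b] else [::]) n1.
Qed.

Lemma fp_push_cons x s : fp_reduced (x :: s) -> fp_push x s = x :: s.
Proof.
rewrite fp_reduced_cons => /and3P[nx _ ax].
by case: x s nx ax => [a|b] [|[a'|b'] s] //= ->.
Qed.

(** A push affects at most the first syllable. *)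
Lemma fp_push_cat x y s t : fp_push x ((y :: s) ++ t) = fp_push x (y :: s) ++ t.
Proof. by case: x y => [a|b] [a'|b'] //=; case: eqP. Qed.

Definition syllable_wlen x :=
  match x with inl a => wlen A a | inr b => wlen B b end.

Definition total_wlen s : nat := \sum_(x <- s) syllable_wlen x.

Lemma total_wlen_cons x s :
  total_wlen (x :: s) = (syllable_wlen x + total_wlen s)%N.
Proof. by rewrite /total_wlen big_cons. Qed.

Lemma total_wlen_push x s :
  (total_wlen (fp_push x s) <= syllable_wlen x + total_wlen s)%N.
Proof.
have nt y t :
  (total_wlen (if fp_nontrivial y then y :: t else t)
     <= syllable_wlen y + total_wlen t)%N.
  by case: ifP => _; rewrite ?total_wlen_cons ?leq_addl.
case: s => [|y s]; first by case: x => x; apply: nt.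
case: x y => [a|b] [a'|b'] /=.
- case: eqP => _; rewrite !total_wlen_cons addnA ?leq_addl //=.
  by rewrite leq_add2r wlenM.
- exact: (nt (inl a) (inr b' :: s)).
- exact: (nt (inr b) (inl a' :: s)).
- case: eqP => _; rewrite !total_wlen_cons addnA ?leq_addl //=.
  by rewrite leq_add2r wlenM.
Qed.

Definition left_letter c := if c is inl _ then true else false.

Definition syllable_left x := if x is inl _ then true else false.

(** Either [x] is trivial or cancels the first syllable, and no length is gained, or it survives in
    the first syllable of the result. *)
Lemma fp_push_head x s : (total_wlen (fp_push x s) <= total_wlen s)%N \/
  exists y t, fp_push x s = y :: t /\ syllable_left y = syllable_left x.
Proof.
case: x s => [a|b] [|[a'|b'] s] /=; case: ifP => _; rewrite ?total_wlen_cons;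
  try (by left; rewrite ?leq_addl); by right; do 2!eexists.
Qed.

Definition normal_form w := fpval (wordval (map ltr w)).

Definition syllable_of c : G + H :=
  match c with inl a => inl (val a) | inr b => inr (val b) end.

Lemma normal_form_cons c w :
  normal_form (c :: w) = fp_push (syllable_of c) (normal_form w).
Proof.
rewrite /normal_form /wordval big_cons.
by case: c => z; [exact: fpval_mul_inl | exact: fpval_mul_inr].
Qed.

Lemma total_wlen_normal_form w : (total_wlen (normal_form w) <= size w)%N.
Proof.
elim: w => [|c w IHw].
  by rewrite /normal_form /wordval big_nil /total_wlen big_nil.
rewrite normal_form_cons; apply: leq_trans (total_wlen_push _ _) _.
rewrite -[size _]/(1 + size w)%N leq_add //.
by case: c => z /=; have := wlen_wordval [:: z]; rewrite /wordval big_seq1.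
Qed.

Lemma freeprod_word (u : freeprod G H) :
  exists2 w, wordval (map ltr w) = u & size w = total_wlen u.
Proof.
case: u => s rs; elim: s rs => [|x s IHs] rs.
  exists [::]; last by rewrite /total_wlen big_nil.
  by rewrite /wordval big_nil; apply: val_inj.
have [_ rs' _] := and3P (etrans (esym (fp_reduced_cons x s)) rs).
have [w wE sz] := IHs rs'.
case: x => [a|b] in rs *.
- have [v vE szv] := wlenP A_span a.
  exists (map inl v ++ w); last first.
    by rewrite size_cat size_map szv sz /= total_wlen_cons.
  rewrite map_cat wordval_cat wE wordval_inl; last exact: fp_inlM.
  apply: val_inj; rewrite vE.
  exact: (etrans (fpval_mul_inl a (FreeProd rs')) (fp_push_cons rs)).
- have [v vE szv] := wlenP B_span b.
  exists (map inr v ++ w); last first.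
    by rewrite size_cat size_map szv sz /= total_wlen_cons.
  rewrite map_cat wordval_cat wE wordval_inr; last exact: fp_inrM.
  apply: val_inj; rewrite vE.
  exact: (etrans (fpval_mul_inr b (FreeProd rs')) (fp_push_cons rs)).
Qed.

Lemma freeprod_spanning : spanning X.
Proof. by move=> u; have [w] := freeprod_word u; exists (map ltr w). Qed.

(** Spelling every syllable by a shortest word gives the upper bound; for the lower bound, pushing a
    letter raises the total by at most 1. *)
Lemma wlen_freeprod (u : freeprod G H) : wlen X u = total_wlen u.
Proof.
apply/eqP; rewrite eqn_leq; apply/andP; split.
  have [w <- <-] := freeprod_word u.
  by rewrite -(size_map ltr) wlen_wordval.
have [v <- <-] := wlenP freeprod_spanning u.
have [w <-] := word_letters (f := f) (g := g) v.
by rewrite size_map; apply: total_wlen_normal_form.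
Qed.

Definition fp_geodesic w := geodesic_lang (X := X) (map ltr w).

Lemma fp_geodesicE w : fp_geodesic w = (size w == total_wlen (normal_form w)).
Proof. by rewrite /fp_geodesic /geodesic_lang /= size_map wlen_freeprod. Qed.

Lemma fp_geodesic_split u v :
  fp_geodesic (u ++ v) -> fp_geodesic u && fp_geodesic v.
Proof.
by rewrite /fp_geodesic map_cat => /(geodesic_cat freeprod_spanning).
Qed.

(** In a geodesic word the first letter strictly increases the length, which excludes the first
    alternative of [fp_push_head]. *)
Lemma normal_form_head c w : fp_geodesic (c :: w) ->
  exists y s, normal_form (c :: w) = y :: s /\ syllable_left y = left_letter c.
Proof.
move=> cw; have /andP[_] := fp_geodesic_split (u := [:: c]) cw.
move: cw; rewrite !fp_geodesicE normal_form_cons => /eqP cw /eqP w_geod.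
have [|[y [s [-> yc]]]] := fp_push_head (syllable_of c) (normal_form w).
  by rewrite -cw -w_geod ltnn.
by exists y, s; split=> //; rewrite yc; case: (c).
Qed.

(** Nothing merges at the change of factor. Further letters act only on the front part, whose normal
    form stays nonempty because suffixes of a geodesic are geodesic. *)
Lemma normal_form_cat c u d v : left_letter (last c u) != left_letter d ->
    fp_geodesic (c :: u) -> fp_geodesic (d :: v) ->
  normal_form ((c :: u) ++ d :: v) =
    normal_form (c :: u) ++ normal_form (d :: v).
Proof.
move=> + + dv; elim: u c => [|c' u IHu] c /= cd cu.
  have [y [s [yE yd]]] := normal_form_head dv.
  rewrite !normal_form_cons -normal_form_cons yE.
  have -> : normal_form [::] = [::] by rewrite /normal_form /wordval big_nil.
  move: cd; rewrite -yd; clear; case: c y => [a|b] [a'|b'] //=;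
    by case: ifP.
have /andP[_ cu'] := fp_geodesic_split (u := [:: c]) cu.
rewrite normal_form_cons -cat_cons IHu // [in RHS]normal_form_cons.
have [y [s [-> _]]] := normal_form_head cu'.
by rewrite fp_push_cat.
Qed.

Lemma fp_geodesic_cat c u d v : left_letter (last c u) != left_letter d ->
  fp_geodesic ((c :: u) ++ d :: v) =
    fp_geodesic (c :: u) && fp_geodesic (d :: v).
Proof.
move=> cd; apply/idP/andP => [/fp_geodesic_split/andP//|[cu dv]].
rewrite fp_geodesicE normal_form_cat // /total_wlen big_cat size_cat.
by move: cu dv; rewrite !fp_geodesicE => /eqP -> /eqP ->.
Qed.

Lemma fp_geodesic_nil : fp_geodesic [::].
Proof.
by rewrite fp_geodesicE /normal_form /wordval big_nil /total_wlen big_nil.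
Qed.

Definition fp_conj_geodesic w := conj_geodesic_lang (X := X) (map ltr w).

Lemma fp_conj_geodesic_rot r w : fp_conj_geodesic (rot r w) =
  fp_conj_geodesic w.
Proof. by rewrite /fp_conj_geodesic map_rot conj_geodesic_rot. Qed.

(** Consecutive copies of the word meet at a change of factor, so all its powers are geodesic and
    [conj_wlen_stable] applies. *)
Lemma fp_conj_geodesicE c w : left_letter c -> ~~ left_letter (last c w) ->
  fp_conj_geodesic (c :: w) = fp_geodesic (c :: w).
Proof.
move=> lc lw; apply/idP/idP => [/conj_geodesicW//|cw].
rewrite /fp_conj_geodesic /conj_geodesic_lang /= conj_wlen_stable //.
  exact: freeprod_spanning.
move=> n; pose wn := flatten (nseq n (c :: w)).
have wn_geod : fp_geodesic wn.
  rewrite /wn; elim: n {wn} => [|n IHn]; first exact: fp_geodesic_nil.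
  rewrite -[flatten _]/((c :: w) ++ flatten (nseq n (c :: w))).
  case: n IHn => [|n] IHn; first by rewrite /= cats0.
  rewrite -[flatten _]/(c :: (w ++ flatten (nseq n (c :: w)))) in IHn *.
  by rewrite fp_geodesic_cat ?cw // lc (negPf lw).
have wnE : wordval (map ltr wn) = wordval (map ltr (c :: w)) ^+ n.
  rewrite /wn; elim: n {wn wn_geod} => [|n IHn].
    by rewrite /wordval big_nil.
  by rewrite expgS -IHn -wordval_cat -map_cat.
have := wn_geod; rewrite /fp_geodesic /geodesic_lang /= wnE size_map => /eqP <-.
have := cw; rewrite /fp_geodesic /geodesic_lang /= size_map => /eqP <-.
by rewrite size_flatten /shape map_nseq sumn_nseq mulnC.
Qed.

End FreeProductWords.

Lemma fps_addE (R : comNzRingType) (u v : fps R) n : (u + v) n = u n + v n.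
Proof. by []. Qed.

Lemma fps_oppE (R : comNzRingType) (u : fps R) n : (- u) n = - u n.
Proof. by []. Qed.

Lemma fpsX_deriv (F : fieldType) (u : fps F) n :
  (fpsX F * fps_deriv u) n = n%:R * u n.
Proof.
case: n => [|n]; rewrite [LHS]big_ord_recl /= mul0r add0r.
  by rewrite big_ord0 mul0r.
rewrite big_ord_recl /= mul1r big1 => [|i _]; last by rewrite mul0r.
by rewrite addr0 subn1 mulr_natl.
Qed.

Lemma growth_series_nil (T : finType) :
  growth_series [pred w : seq T | w == [::]] = 1.
Proof.
apply: fpsP => -[|n]; rewrite growth_seriesE; first by rewrite wseries0.
by rewrite /= big1 // => -[[|x w]].
Qed.

Lemma growth_series_all (S T : finType) (f : S -> T) (L : pred (seq T))
    (P : pred T) : injective f -> (forall x, P x -> x \in codom f) ->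
    (forall x, P (f x)) ->
  growth_series [pred w | all P w && L w] =
    growth_series [pred s | L (map f s)].
Proof.
move=> f_inj Pf fP; rewrite (growth_series_map (f := f)) => [|w|s _ x _ y].
- congr growth_series; apply: funext => s /=.
  by rewrite all_map (eq_all (a2 := predT)) ?all_predT // => x; apply: fP.
- by move=> /andP[/allP wP _] x /wP /Pf.
- exact: f_inj.
Qed.

(** * Assembling the series of the free product *)

Section FreeProductSeries.
Variables (G H : groupType) (A : {fset G}) (B : {fset H}).
Hypotheses (A_span : spanning A) (B_span : spanning B).
Local Notation X := (fprod_gens A B).
Local Notation in_left := (@left_letter G H A B).

Lemma left_series (L : pred (seq (A + B))) (L' : pred (seq A)) :
    (forall u, L (map inl u) = L' u) ->
  growth_series [pred w | all (fun c => in_left c == true) w && L w]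
  = growth_series L'.
Proof.
move=> LL'; rewrite (growth_series_all (f := inl)) => [|a b [] //|[a|b] //|//].
- by congr growth_series; apply: funext => u /=.
- by rewrite codom_f.
Qed.

Lemma right_series (L : pred (seq (A + B))) (L' : pred (seq B)) :
    (forall u, L (map inr u) = L' u) ->
  growth_series [pred w | all (fun c => in_left c == false) w && L w]
  = growth_series L'.
Proof.
move=> LL'; rewrite (growth_series_all (f := inr)) => [|a b [] //|[a|b] //|//].
- by congr growth_series; apply: funext => u /=.
- by rewrite codom_f.
Qed.

Lemma syllable_seriesE b :
  syllable_series in_left (@fp_geodesic G H A B) b =
  growth_series [pred w | all (fun c => in_left c == b) w && fp_geodesic w] - 1.
Proof.
apply/eqP; rewrite eq_sym subr_eq -(growth_series_nil (A + B)%type); apply/eqP.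
rewrite /syllable_series !growth_seriesE; apply: fpsP => n.
rewrite fps_addE /= -big_split; apply: eq_bigr => w _ /=.
rewrite /syllable /=; case: (tval w) => [|c u] /=.
  by rewrite (fp_geodesic_nil A_span B_span) add0r.
by rewrite addr0.
Qed.

Lemma conj_geodesic_growth_fprod :
  conj_geodesic_growth X - 1 =
    (conj_geodesic_growth A - 1) + (conj_geodesic_growth B - 1)
    - fpsX rat * fps_deriv (fps_ln1B ((geodesic_growth A - 1)
                                       * (geodesic_growth B - 1))).
Proof.
have id_M (K : groupType) : {morph (fun x : K => x) : x y / (x * y)%g} by [].
have one_M (K K' : groupType) :
  {morph (fun _ : K => 1%g : K') : x y / (x * y)%g}.
  by move=> x y; rewrite mulg1.
(* The retractions come from the universal property, with the identity on one factor and the trivial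
   map on the other. *)
have [f' [f'M fK f'g]] := freeprod_retraction (id_M G) (one_M H G).
have [g' [g'M g'f gK]] := freeprod_retraction (one_M G H) (id_M H).
have fM := @fp_inlM G H; have gM := @fp_inrM G H.
have X_span := freeprod_spanning A_span B_span.
have sA : syllable_series in_left (@fp_geodesic G H A B) true =
    geodesic_growth A - 1.
  rewrite syllable_seriesE; congr (_ - _); apply: left_series => u.
  exact: (geodesic_inl fM gM f'M g'M fK gK f'g g'f A_span B_span X_span).
have sB : syllable_series in_left (@fp_geodesic G H A B) false =
    geodesic_growth B - 1.
  rewrite syllable_seriesE; congr (_ - _); apply: right_series => u.
  exact: (geodesic_inr fM gM f'M g'M fK gK f'g g'f A_span B_span X_span).
have cA : growth_series [pred w | all (fun c => in_left c == true) w
    && fp_conj_geodesic w] = conj_geodesic_growth A.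
  apply: left_series => u.
  exact: (conj_geodesic_inl fM gM f'M g'M fK gK f'g g'f A_span B_span X_span).
have cB : growth_series [pred w | all (fun c => in_left c == false) w
    && fp_conj_geodesic w] = conj_geodesic_growth B.
  apply: right_series => u.
  exact: (conj_geodesic_inr fM gM f'M g'M fK gK f'g g'f A_span B_span X_span).
have -> : conj_geodesic_growth X =
    growth_series [pred w | @fp_conj_geodesic G H A B w].
  exact: (conj_geodesic_growth_letters fM fK gK f'g X_span).
have c_nil : @fp_conj_geodesic G H A B [::].
  exact: conj_geodesic_nil.
(* Words are purely left, purely right or mixed; the empty word is both purely left and purely
   right, hence the added 1. *)
have cE : growth_series [pred w | @fp_conj_geodesic G H A B w] + 1 =
    conj_geodesic_growth A + conj_geodesic_growth B
    + growth_series [pred w | fp_conj_geodesic w && mixed in_left w].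
  rewrite -(growth_series_nil (A + B)%type) -cA -cB !growth_seriesE.
  apply: fpsP => n; rewrite !fps_addE /= -!big_split.
  apply: eq_bigr => w _ /=; rewrite /mixed.
  have -> : all (fun c => in_left c == true) w = ~~ has (predC in_left) w.
    by rewrite -all_predC; apply: eq_all => c /=; case: (in_left c).
  have -> : all (fun c => in_left c == false) w = ~~ has in_left w.
    by rewrite -all_predC; apply: eq_all => c /=; case: (in_left c).
  case: (tval w) => [|c u]; first by rewrite c_nil.
  case: (fp_conj_geodesic _); last by rewrite !andbF.
  rewrite /= !andbT; case: (in_left c) => /=; rewrite ?orbT ?orbF /=.
    by case: (has (predC _) u); rewrite /= !addr0 ?add0r.
  by case: (has _ u); rewrite /= ?addr0 ?add0r.
have mE : growth_series [pred w | fp_conj_geodesic w && mixed in_left w] =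
    - (fpsX rat * fps_deriv (fps_ln1B ((geodesic_growth A - 1)
                                       * (geodesic_growth B - 1)))).
  (* The operator z d/dz multiplies the coefficient of degree [n] by [n]; the outer sign cancels
     that of [fps_ln1B]. *)
  apply: fpsP => n; rewrite fps_oppE fpsX_deriv -mulrN [- _]opprK -sA -sB.
  apply: mixed_cyclic_series.
  - exact: fp_geodesic_nil.
  - exact: fp_geodesic_cat.
  - exact: fp_conj_geodesic_rot.
  - exact: fp_conj_geodesicE.
rewrite -mE -[growth_series _](addrK 1) cE; ring.
Qed.

End FreeProductSeries.

Theorem theorem3p8 (G H : groupType) (A : {fset G}) (B : {fset H})
    (A_inv : inverse_closed A) (A_gen : generates A)
    (B_inv : inverse_closed B) (B_gen : generates B) :
  (conj_geodesic_growth (dprod_gens A B) =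
     Fps (fun i => \sum_(j < i.+1) 'C(i, j)%:R
                     * conj_geodesic_growth A j
                     * conj_geodesic_growth B (i - j)%N))
  /\
  (conj_geodesic_growth (fprod_gens A B) - 1 =
     (conj_geodesic_growth A - 1) + (conj_geodesic_growth B - 1)
     - fpsX rat * fps_deriv (fps_ln1B ((geodesic_growth A - 1)
                                        * (geodesic_growth B - 1)))).
Proof.
have A_span := generates_spanning A_inv A_gen.
have B_span := generates_spanning B_inv B_gen.
by split; [exact: conj_geodesic_growth_dprod | exact: conj_geodesic_growth_fprod].
Qed.
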